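(* For each integer $i\geq2$ let $r_i\in\mathbb{Z}_{>0}$ and $e_i\in\mathbb{Z}_{\geq0}$ be given, and assume that $\sum_i e_i<\infty$. If $\gcd(i-1,r_i)=1$ for every $i$ such that $e_i>0$, then there is an injective group homomorphism $$\mathrm{Out}\left(\prod_{i\geq2}F_i^{e_i}\right)\hookrightarrow\mathrm{Out}\left(\prod_{i\geq2}F_{r_i^i(i-1)+1}^{e_i}\right).$$
   Context: $F_n$ is the free group of rank $n$; $G^{e}$ denotes the direct product of $e$ copies of $G$. $\mathrm{Out}(G)=\mathrm{Aut}(G)/\mathrm{Inn}(G)$. *)

(* Defs.v *)
From HB Require Import structures.
From mathcomp Require Import all_boot.
From mathcomp Require Import boolp.

Set Implicit Arguments.
Unset Strict Implicit.
Unset Printing Implicit Defensive.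

Local Open Scope group_scope.
Local Open Scope quotient_scope.

Section FreeGroup.
Variable X : choiceType.

(* (x, false) is the letter x and (x, true) is the letter x^-1. *)
Definition letter : Type := (X * bool)%type.

Definition letter_inv (a : letter) : letter := (a.1, ~~ a.2).

Definition reduced (w : seq letter) : bool :=
  sorted (fun a b => b != letter_inv a) w.

Record freeGroup := FreeWord { fword :> seq letter; _ : reduced fword }.

HB.instance Definition _ := [isSub for fword].
HB.instance Definition _ := [Choice of freeGroup by <:].

(* The reduced form of a :: w, for w reduced. *)
Definition fpush (a : letter) (w : seq letter) : seq letter :=
  if w is b :: w' then if b == letter_inv a then w' else a :: w else [:: a].

(* The reduced form of u ++ w, for w reduced. *)
Definition fcat (u w : seq letter) : seq letter := foldr fpush w u.

Definition finvw (w : seq letter) : seq letter := rev (map letter_inv w).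

Lemma letter_invK : involutive letter_inv.
Proof. by case=> x b; rewrite /letter_inv /= negbK. Qed.

Lemma letter_inv_neq a : letter_inv a != a.
Proof. by case: a => x [] /=; apply/eqP => -[]. Qed.

Lemma reduced_tail a w : reduced (a :: w) -> reduced w.
Proof. by rewrite /reduced /=; apply: path_sorted. Qed.

Lemma reduced_fpush a w : reduced w -> reduced (fpush a w).
Proof.
case: w => [//|b w] rw /=; case: ifPn => [_|nba]; first exact: reduced_tail rw.
by rewrite /reduced /= nba.
Qed.

Lemma reduced_fcat u w : reduced w -> reduced (fcat u w).
Proof. by move=> rw; elim: u => //= a u /reduced_fpush. Qed.

Lemma fpushK a w : reduced w -> fpush (letter_inv a) (fpush a w) = w.
Proof.
case: w => [_|b w rw] /=; first by rewrite letter_invK eqxx.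
case: ifPn => [/eqP def_b|_] /=; last by rewrite letter_invK eqxx.
case: w rw => [_|c w]; first by rewrite /= -def_b.
rewrite /reduced /= => /andP[ncb _]; rewrite -def_b.
by rewrite (negPf ncb).
Qed.

Lemma fpushVK a w : reduced w -> fpush a (fpush (letter_inv a) w) = w.
Proof. by move=> rw; rewrite -{1}[a]letter_invK fpushK. Qed.

Lemma fcat_fpush a u w :
  reduced u -> reduced w -> fcat (fpush a u) w = fpush a (fcat u w).
Proof.
case: u => [//|b u] ru rw /=; case: ifP => [/eqP->|//].
by rewrite fpushVK //; apply: reduced_fcat.
Qed.

Lemma fcatA u v w :
  reduced v -> reduced w -> fcat u (fcat v w) = fcat (fcat u v) w.
Proof.
move=> rv rw; elim: u => //= a u ->.
by rewrite fcat_fpush //; apply: reduced_fcat.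
Qed.

Lemma fcat0 w : reduced w -> fcat w [::] = w.
Proof.
elim: w => //= a w IHw raw; rewrite IHw; last exact: reduced_tail raw.
by case: w raw {IHw} => //= b w /andP[/negPf->].
Qed.

Lemma fcatVw w : fcat (finvw w) w = [::].
Proof.
elim: w => //= a w IHw; rewrite /finvw /= rev_cons /fcat foldr_rcons /=.
by rewrite letter_invK eqxx.
Qed.

Lemma finvwK : involutive finvw.
Proof.
move=> w; rewrite /finvw map_rev revK -map_comp -[RHS]map_id.
by apply: eq_map; apply: letter_invK.
Qed.

Lemma fcatwV w : fcat w (finvw w) = [::].
Proof. by rewrite -{1}[w]finvwK fcatVw. Qed.

Lemma reduced_finvw w : reduced w -> reduced (finvw w).
Proof.
rewrite /reduced /finvw rev_sorted sorted_map; apply: sub_sorted => a b /=.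
by apply: contraNneq => ->; rewrite letter_invK.
Qed.

Lemma fwordP (w : freeGroup) : reduced w. Proof. exact: valP w. Qed.

Definition free_one : freeGroup := @FreeWord [::] isT.
Definition free_inv (w : freeGroup) : freeGroup :=
  FreeWord (reduced_finvw (fwordP w)).
Definition free_mul (u w : freeGroup) : freeGroup :=
  FreeWord (reduced_fcat u (fwordP w)).

Fact free_mulA : associative free_mul.
Proof. by move=> u v w; apply: val_inj; apply: fcatA; apply: fwordP. Qed.
Fact free_mul1 : left_id free_one free_mul.
Proof. by move=> w; apply: val_inj. Qed.
Fact free_mulr1 : right_id free_one free_mul.
Proof. by move=> w; apply: val_inj; apply: fcat0; apply: fwordP. Qed.
Fact free_mulV : left_inverse free_one free_inv free_mul.
Proof. by move=> w; apply: val_inj; apply: fcatVw. Qed.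
Fact free_mulrV : right_inverse free_one free_inv free_mul.
Proof. by move=> w; apply: val_inj; apply: fcatwV. Qed.

HB.instance Definition _ :=
  isGroup.Build freeGroup free_mulA free_mul1 free_mulr1 free_mulV free_mulrV.

Definition free_gen (x : X) : freeGroup := @FreeWord [:: (x, false)] isT.

Section Lift.
Variables (G : groupType) (f : X -> G).

Definition letter_val (a : letter) : G := if a.2 then (f a.1)^-1 else f a.1.

Definition free_lift (w : freeGroup) : G :=
  foldr (fun a => mul (letter_val a)) 1 w.

Lemma letter_valV a : letter_val (letter_inv a) = (letter_val a)^-1.
Proof. by case: a => x []; rewrite /letter_val //= invgK. Qed.

Fact free_liftM : {morph free_lift : u w / u * w}.
Proof.
move=> u w; rewrite /free_lift /=; elim: (fword u) => [|a s IHs] /=.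
  by rewrite mul1g.
rewrite -mulgA -{}IHs; case: (fcat s w) => [//|b t] /=.
by case: ifP => [/eqP->|//]; rewrite letter_valV mulVKg.
Qed.

HB.instance Definition _ := isMultiplicative.Build _ _ free_lift free_liftM.

Lemma free_lift_gen x : free_lift (free_gen x) = f x.
Proof. by rewrite /free_lift /= mulg1. Qed.

Lemma free_lift_uniq (g : Multiplicative.type freeGroup G) :
  (forall x, g (free_gen x) = f x) -> g =1 free_lift.
Proof.
move=> gE; have g1 : g 1 = 1.
  by apply: (mulgI (g 1)); rewrite -gmulfM !mulg1.
have gV u : g u^-1 = (g u)^-1.
  by apply: (mulgI (g u)); rewrite -gmulfM !mulgV.
case=> w; elim: w => [|a w IHw] rw.
  by rewrite /free_lift /= -g1; congr (g _); apply: val_inj.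
have ra : reduced [:: a] by [].
have -> : FreeWord rw = FreeWord ra * FreeWord (reduced_tail rw).
  apply: val_inj => /=; case: w rw {IHw} => //= b w /andP[/negPf nb _].
  by rewrite nb.
rewrite gmulfM free_liftM IHw; congr (_ * _).
rewrite /free_lift /= mulg1 /letter_val; case: a {rw} ra => x [] ra /=.
  rewrite -gE -gV; congr (g _); exact: val_inj.
rewrite -gE; congr (g _); exact: val_inj.
Qed.

End Lift.
End FreeGroup.

Definition Free (n : nat) : groupType := freeGroup 'I_n.

Section DirectProduct.
Variables (I : Type) (G : I -> groupType).

Definition dirprod : Type := forall i, G i.

HB.instance Definition _ := Choice.on dirprod.

Definition dirprod_one : dirprod := fun=> 1.
Definition dirprod_inv (x : dirprod) : dirprod := fun i => (x i)^-1.
Definition dirprod_mul (x y : dirprod) : dirprod := fun i => x i * y i.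

Fact dirprod_mulA : associative dirprod_mul.
Proof. by move=> x y z; apply: functional_extensionality_dep => i;
   apply: mulgA. Qed.
Fact dirprod_mul1 : left_id dirprod_one dirprod_mul.
Proof. by move=> x; apply: functional_extensionality_dep => i;
   apply: mul1g. Qed.
Fact dirprod_mulr1 : right_id dirprod_one dirprod_mul.
Proof. by move=> x; apply: functional_extensionality_dep => i;
   apply: mulg1. Qed.
Fact dirprod_mulV : left_inverse dirprod_one dirprod_inv dirprod_mul.
Proof. by move=> x; apply: functional_extensionality_dep => i;
   apply: mulVg. Qed.
Fact dirprod_mulrV : right_inverse dirprod_one dirprod_inv dirprod_mul.
Proof. by move=> x; apply: functional_extensionality_dep => i;
   apply: mulgV. Qed.

HB.instance Definition _ :=
  isGroup.Build dirprod dirprod_mulA dirprod_mul1 dirprod_mulr1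
    dirprod_mulV dirprod_mulrV.

End DirectProduct.

Section Aut.
Variable G : groupType.

Definition is_aut (f : G -> G) : Prop :=
  bijective f /\ {morph f : x y / x * y}.

Record Aut := MkAut { aut_fun :> G -> G; _ : `[< is_aut aut_fun >] }.

HB.instance Definition _ := [isSub for aut_fun].
HB.instance Definition _ := [Choice of Aut by <:].

Lemma autP (f : Aut) : is_aut f. Proof. exact: asboolW (valP f). Qed.

Lemma autM (f : Aut) : {morph f : x y / x * y}.
Proof. by have [] := autP f. Qed.

HB.instance Definition _ (f : Aut) :=
  isMultiplicative.Build G G (aut_fun f) (autM f).

Lemma aut_eq (f h : Aut) : f =1 h -> f = h.
Proof. by move=> fh; apply: val_inj; apply: funext. Qed.

Lemma is_aut_id : is_aut id.
Proof. by split=> //; exists id. Qed.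

Lemma is_aut_comp (f h : Aut) : is_aut (f \o h).
Proof.
have [[bf mf] [bh mh]] := (autP f, autP h); split; first exact: bij_comp.
by move=> x y; rewrite /= mh mf.
Qed.

Lemma aut_inv_subproof (f : Aut) : {h : G -> G | cancel f h /\ cancel h f}.
Proof. by apply: cid; have [[h fK hK] _] := autP f; exists h. Qed.

Lemma is_aut_inv (f : Aut) : is_aut (sval (aut_inv_subproof f)).
Proof.
case: (aut_inv_subproof f) => h [fK hK] /=; split; first by exists f.
by move=> x y; apply: (can_inj fK); rewrite autM !hK.
Qed.

Definition aut_one : Aut := MkAut (asboolT is_aut_id).
Definition aut_mul (f h : Aut) : Aut := MkAut (asboolT (is_aut_comp f h)).
Definition aut_inv (f : Aut) : Aut := MkAut (asboolT (is_aut_inv f)).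

Fact aut_mulA : associative aut_mul.
Proof. by move=> f g h; apply: aut_eq. Qed.
Fact aut_mul1 : left_id aut_one aut_mul.
Proof. by move=> f; apply: aut_eq. Qed.
Fact aut_mulr1 : right_id aut_one aut_mul.
Proof. by move=> f; apply: aut_eq. Qed.
Fact aut_mulV : left_inverse aut_one aut_inv aut_mul.
Proof.
move=> f; apply: aut_eq => x /=.
by case: (aut_inv_subproof f) => h [fK hK] /=; apply: fK.
Qed.
Fact aut_mulrV : right_inverse aut_one aut_inv aut_mul.
Proof.
move=> f; apply: aut_eq => x /=.
by case: (aut_inv_subproof f) => h [fK hK] /=; apply: hK.
Qed.

HB.instance Definition _ :=
  isGroup.Build Aut aut_mulA aut_mul1 aut_mulr1 aut_mulV aut_mulrV.

Lemma autE1 x : (1 : Aut) x = x. Proof. by []. Qed.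
Lemma autEM (f h : Aut) x : (f * h) x = f (h x). Proof. by []. Qed.
Lemma autVK (f : Aut) : cancel f^-1 f.
Proof. by move=> x; rewrite -autEM mulgV. Qed.
Lemma autKV (f : Aut) : cancel f f^-1.
Proof. by move=> x; rewrite -autEM mulVg. Qed.

Definition Inn : {pred Aut} :=
  [pred f : Aut | `[< exists g : G, forall x, f x = g * x * g^-1 >]].

Lemma InnP (f : Aut) :
  reflect (exists g : G, forall x, f x = g * x * g^-1) (f \in Inn).
Proof. exact: asboolP. Qed.

Fact Inn1 : 1 \in Inn.
Proof. by apply/InnP; exists 1 => x; rewrite autE1 invg1 mulg1 mul1g. Qed.

Fact InnM : mulg_closed Inn.
Proof.
move=> f h /InnP[a fE] /InnP[b hE]; apply/InnP; exists (a * b) => x.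
by rewrite autEM fE hE invgM !mulgA.
Qed.

Fact InnV : invg_closed Inn.
Proof.
move=> f /InnP[a fE]; apply/InnP; exists a^-1 => x.
by apply: (can_inj (autKV f)); rewrite autVK fE invgK !mulgA mulgV mul1g mulgK.
Qed.

HB.instance Definition _ := isMul1Closed.Build Aut Inn Inn1.
HB.instance Definition _ := isMulClosed.Build Aut Inn InnM.
HB.instance Definition _ := isInvClosed.Build Aut Inn InnV.

Lemma InnJ (f h : Aut) : f \in Inn -> f ^ h \in Inn.
Proof.
move/InnP=> [a fE]; apply/InnP; exists (h^-1 a) => x.
rewrite !autEM fE; apply: (can_inj (autKV h)); rewrite autVK !autM autVK.
by congr (_ * _); apply: (mulgI a); rewrite mulgV -{1}[a](autVK h) -!autM mulgV;
  apply: (mulgI (h 1)); rewrite -autM !mulg1.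
Qed.

Definition out_rel (f h : Aut) : bool := f^-1 * h \in Inn.

Fact out_rel_refl : reflexive out_rel.
Proof. by move=> f; rewrite /out_rel mulVg Inn1. Qed.
Fact out_rel_sym : symmetric out_rel.
Proof. by move=> f h; rewrite /out_rel -gpredV invgM invgK. Qed.
Fact out_rel_trans : transitive out_rel.
Proof.
move=> h f k; rewrite /out_rel => fh hk.
by have := InnM fh hk; rewrite !mulgA mulgK.
Qed.

Canonical out_equiv := EquivRel out_rel out_rel_refl out_rel_sym out_rel_trans.

Definition Out : Type := {eq_quot out_equiv}.

HB.instance Definition _ := EqQuotient.on Out.
HB.instance Definition _ := Choice.on Out.

Definition out_pi (f : Aut) : Out := \pi_Out f.

Lemma out_piP (f h : Aut) : reflect (out_pi f = out_pi h) (f^-1 * h \in Inn).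
Proof. exact: (eqmodP out_equiv f h). Qed.

Lemma out_reprK (c : Out) : out_pi (repr c) = c. Proof. exact: reprK. Qed.

Definition out_one : Out := out_pi 1.
Definition out_mul (c d : Out) : Out := out_pi (repr c * repr d).
Definition out_inv (c : Out) : Out := out_pi (repr c)^-1.

Fact out_piM : {morph out_pi : f h / f * h >-> out_mul f h}.
Proof.
move=> f h; apply/out_piP.
have /out_piP fr : out_pi f = out_pi (repr (out_pi f)) by rewrite out_reprK.
have /out_piP hr : out_pi h = out_pi (repr (out_pi h)) by rewrite out_reprK.
have := InnM (InnJ h fr) hr; rewrite conjgE invgM !mulgA mulgK.
by [].
Qed.

Fact out_piV : {morph out_pi : f / f^-1 >-> out_inv f}.
Proof.
move=> f; apply/out_piP.
have /out_piP fr : out_pi f = out_pi (repr (out_pi f)) by rewrite out_reprK.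
have := InnJ f^-1 (InnV fr).
rewrite conjgE invgM !invgK !mulgA => fr'.
by move: fr'; rewrite mulgK.
Qed.

Fact out_mulA : associative out_mul.
Proof.
move=> a b c; rewrite -[a]out_reprK -[b]out_reprK -[c]out_reprK.
by rewrite -!out_piM mulgA.
Qed.
Fact out_mul1 : left_id out_one out_mul.
Proof. by move=> a; rewrite -[a]out_reprK -out_piM mul1g. Qed.
Fact out_mulr1 : right_id out_one out_mul.
Proof. by move=> a; rewrite -[a]out_reprK -out_piM mulg1. Qed.
Fact out_mulV : left_inverse out_one out_inv out_mul.
Proof. by move=> a; rewrite -[a]out_reprK -out_piV -out_piM mulVg. Qed.
Fact out_mulrV : right_inverse out_one out_inv out_mul.
Proof. by move=> a; rewrite -[a]out_reprK -out_piV -out_piM mulgV. Qed.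

HB.instance Definition _ :=
  isGroup.Build Out out_mulA out_mul1 out_mulr1 out_mulV out_mulrV.

HB.instance Definition _ := isMultiplicative.Build Aut Out out_pi out_piM.

End Aut.

(* prod_(i >= 2) F_(m i)^(e i); factors with e i = 0 are functions on 'I_0,
   i.e. trivial, so for finitely supported e the product is a finite one. *)
Definition prodFree (m e : nat -> nat) : groupType :=
  dirprod (fun i : {i : nat | 2 <= i} =>
    {ffun 'I_(e (val i)) -> Free (m (val i))}).

(* Main.v *)
Require Import Defs.
From HB Require Import structures.
From mathcomp Require Import all_boot all_algebra fingroup perm.
From mathcomp Require Import boolp zify ring.

(** The argument has two halves: a finite characteristic cover of each free
    factor, and a rigidity statement for automorphisms of the product.

    Let [K] be the kernel of [F_n -> (Z/r)^n].  It is characteristic and, by the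
    index formula, free of rank [r^n (n - 1) + 1] ([cong_free]).  Restriction
    gives a map [Aut(F_n) -> Aut(K)], but inner automorphisms of [F_n] need not
    restrict to inner automorphisms of [K], so one needs a subgroup [S] of
    [Aut(F_n)] that still surjects onto [Out(F_n)] and meets [Inn(F_n)] exactly
    in the conjugations by [K].  Such a subgroup comes from a crossed
    homomorphism [chi : Aut(F_n) -> Z^n] taking the value [(n - 1) [g]] on
    conjugation by [g]: let [S] be the set where [chi] vanishes modulo [r].
    Since [n - 1] is invertible modulo [r], every automorphism can be corrected
    by an inner one to land in [S], and an inner automorphism in [S] is
    conjugation by an element of [K].  The crossed homomorphism used is the
    logarithmic derivative, at the augmentation, of the determinant of the Fox
    Jacobian; it only depends on second-order Magnus coefficients, so it is
    computed in a Heisenberg-like group ([magnus], [chi_comp], [chi_conj]).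

    An automorphism which restricts to the identity on [K] is the identity:
    [x^-1 f(x)] centralises [K], and commutation is transitive on the nontrivial
    elements of a free group ([free_commute_trans]), while [K] is not abelian.
    That these facts make [Out(F_n) -> Out(K)] well defined and injective is
    formal ([out_embedding]).

    For a product of free groups of rank at least 2, transitivity of
    commutation also shows that each coordinate of an automorphism depends on a
    single coordinate of the argument ([depends_ex]), through an isomorphism
    between two factors, necessarily of the same rank.  Since [r] and [chi] only
    see the rank, the construction of [S] and [K] can be carried out coordinate
    by coordinate ([out_free_product]). *)

Set Implicit Arguments.
Unset Strict Implicit.
Unset Printing Implicit Defensive.

(** * Morphisms and free groups *)

Section Morphisms.
Local Open Scope group_scope.
Variables (G H : groupType) (f : G -> H).
Hypothesis fM : {morph f : x y / x * y}.

Lemma morph_one : f 1 = 1.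
Proof. by apply: (mulgI (f 1)); rewrite -fM !mulg1. Qed.

Lemma morph_inv x : f x^-1 = (f x)^-1.
Proof. by apply: (mulgI (f x)); rewrite -fM !mulgV morph_one. Qed.

End Morphisms.

Section FreeBasics.
Local Open Scope group_scope.
Variable X : choiceType.
Implicit Types (u v w : freeGroup X) (a : letter X).

Lemma free_hom_ext (G : groupType) (f g : freeGroup X -> G) :
    {morph f : u v / u * v} -> {morph g : u v / u * v} ->
  (forall x, f (free_gen x) = g (free_gen x)) -> f =1 g.
Proof.
move=> fM gM fg w.
pose F := HB.pack_for (Multiplicative.type (freeGroup X) G) f
  (isMultiplicative.Build _ _ f fM).
pose H := HB.pack_for (Multiplicative.type (freeGroup X) G) g
  (isMultiplicative.Build _ _ g gM).
have fE := @free_lift_uniq _ _ (fun x => f (free_gen x)) F (fun=> erefl) w.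
have gE := @free_lift_uniq _ _ (fun x => f (free_gen x)) H _ w.
by rewrite [f w]fE [g w]gE // => x; rewrite -fg.
Qed.

Definition free_letter a : freeGroup X := @FreeWord X [:: a] isT.

Lemma free_ind (P : freeGroup X -> Prop) :
  P 1 -> (forall a w, P w -> P (free_letter a * w)) -> forall w, P w.
Proof.
move=> P1 PM [w]; elim: w => [|a w IHw] rw.
  by rewrite (_ : FreeWord rw = 1) //; apply: val_inj.
have -> : FreeWord rw = free_letter a * FreeWord (reduced_tail rw).
  apply: val_inj => /=; case: w rw {IHw} => //= b w /andP[/negPf nb _].
  by rewrite nb.
exact/PM/IHw.
Qed.

Lemma free_gen_noncomm (x y : X) :
  x != y -> free_gen x * free_gen y <> free_gen y * free_gen x.
Proof.
move=> /negPf xy /(congr1 (@fword X)) /=.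
by rewrite !xpair_eqE /= !andbF => -[/eqP]; rewrite xy.
Qed.

End FreeBasics.

(** * Commutation in free groups *)

Section CommutingSequences.
Variable T : eqType.
Implicit Types u w x z : seq T.

(** Moving [u] across any number of copies of [w] shows that it is a prefix of
    [w w w ...]; [N] copies are long enough to contain it. *)
Lemma comm_cat_take u w N :
    w != [::] -> u ++ w = w ++ u -> size u <= N ->
  u = take (size u) (flatten (nseq N w)).
Proof.
move=> w0 uw le_uN; set W := flatten _.
have uW : u ++ W = W ++ u.
  rewrite {}/W; elim: N {le_uN} => [|N IHN] /=; first by rewrite cats0.
  by rewrite catA uw -!catA IHN.
have le_uW : size u <= size W.
  rewrite size_flatten /shape map_nseq sumn_nseq (leq_trans le_uN) //.
  by rewrite leq_pmull // lt0n size_eq0.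
by rewrite -[LHS](take_size_cat W (erefl _)) uW takel_cat.
Qed.

(** Both [x ++ z] and [z ++ x] commute with [w], so they are prefixes of the
    same length of the same infinite word. *)
Lemma comm_cat_trans x w z : w != [::] ->
  x ++ w = w ++ x -> z ++ w = w ++ z -> x ++ z = z ++ x.
Proof.
move=> w0 xw zw.
have xzw : (x ++ z) ++ w = w ++ x ++ z by rewrite -catA zw catA xw catA.
have zxw : (z ++ x) ++ w = w ++ z ++ x by rewrite -catA xw catA zw catA.
rewrite (comm_cat_take w0 xzw (leqnn _)) (comm_cat_take w0 zxw (leqnn _)).
by rewrite !size_cat addnC.
Qed.

End CommutingSequences.

Section CommutationTransitivity.
Local Open Scope group_scope.
Variable X : choiceType.
Implicit Types (u v w x y z : freeGroup X) (a b : letter X).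

Lemma reduced_cat (s t : seq (letter X)) a b :
  reduced (rcons s a ++ b :: t) =
    [&& reduced (rcons s a), b != letter_inv a & reduced (b :: t)].
Proof.
by case: s => [|c s] //=; rewrite /reduced /= cat_path last_rcons.
Qed.

Lemma reduced_catl (s t : seq (letter X)) : reduced (s ++ t) -> reduced s.
Proof. by rewrite /reduced => /cat_sorted2[]. Qed.

Lemma fcat_reduced (s t : seq (letter X)) : reduced (s ++ t) -> fcat s t = s ++ t.
Proof.
elim: s => //= a s IHs rst; rewrite IHs; last exact: reduced_tail rst.
by case: (s ++ t) rst {IHs} => //= b r /andP[/negPf->].
Qed.

(** Every cancellation shortens the word by two letters, so a product of full
    length involves no cancellation. *)
Lemma fcat_size (s t : seq (letter X)) :
  size (fcat s t) = (size s + size t)%N -> fcat s t = s ++ t.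
Proof.
have le_push a r : size (fpush a r) <= (size r).+1.
  by case: r => //= b r; case: ifP => //= _; lia.
have le_cat r : size (fcat r t) <= size r + size t.
  elim: r => //= a r IHr; have := le_push a (fcat r t); lia.
elim: s => //= a s IHs sz; rewrite IHs; last first.
  by have := le_push a (fcat s t); have := le_cat s; lia.
have {}IHs : fcat s t = s ++ t.
  by apply: IHs; have := le_push a (fcat s t); have := le_cat s; lia.
move: sz; rewrite IHs; case: (s ++ t) (size_cat s t) => //= b r szr.
by case: ifP => //= _; lia.
Qed.

(** Without cancellation in one of the products, lengths forbid cancellation
    in the other one. *)
Lemma comm_reduced_cat x w :
    commute x w -> reduced (x ++ w) || reduced (w ++ x) ->
  fword x ++ w = fword w ++ x.
Proof.
move=> /(congr1 (@fword X)) /= xw /orP[] r.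
  rewrite -(fcat_reduced r) xw; apply: fcat_size.
  by rewrite -xw fcat_reduced // size_cat addnC.
rewrite -(fcat_reduced r) -xw; apply/esym/fcat_size.
by rewrite xw fcat_reduced // size_cat addnC.
Qed.

Lemma reduced_cat_inv (s w : seq (letter X)) :
    w != [::] -> reduced (w ++ w) -> reduced s -> ~~ reduced (s ++ w) ->
  reduced (w ++ finvw s).
Proof.
case/lastP: s => [|s a]; first by move=> _ /reduced_catl rw _ _; rewrite cats0.
case/lastP: w => // w c _.
case def_w: (rcons w c) => [|b t]; first by case: w def_w.
move=> rww rs nr; have := rww.
rewrite -{1}def_w reduced_cat def_w => /and3P[rw nbc _].
have ab : b = letter_inv a.
  by apply/eqP; move: nr; rewrite reduced_cat rs rw andbT negbK.
rewrite -def_w /finvw map_rcons rev_rcons -ab reduced_cat def_w rw nbc ab.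
by rewrite -rev_rcons -map_rcons reduced_finvw.
Qed.

(** When [w] is cyclically reduced, a cancellation at the end of [x] in [x w]
    forces the last letter of [x] to be the inverse of the first one of [w],
    so that [w x^-1] is reduced. *)
Lemma comm_cyclically_reduced x w :
    fword w != [::] -> reduced (w ++ w) -> commute x w ->
  exists2 x', (x' = x) \/ (x' = x^-1) & fword x' ++ w = fword w ++ x'.
Proof.
move=> w0 rww xw; have [r|nr] := boolP (reduced (x ++ w)).
  by exists x; [left | apply: comm_reduced_cat; rewrite // r].
exists x^-1; first by right.
apply: comm_reduced_cat; first exact/commute_sym/commuteV/commute_sym.
by rewrite /= reduced_cat_inv ?orbT // fwordP.
Qed.

(** While the first and last letters of [y] are inverse to each other, strip
    both of them. *)
Lemma cyclic_reduction y :
  y != 1 -> exists g w, [/\ y = g * w * g^-1, fword w != [::] & reduced (w ++ w)].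
Proof.
have [n] := ubnP (size y); elim: n y => // n IHn [s rs] /= lt_sn y1.
have s0 : s != [::] by apply: contraNneq y1 => s0; apply/eqP/val_inj.
have [rss|nrss] := boolP (reduced (s ++ s)).
  by exists 1, (FreeWord rs); rewrite mul1g invg1 mulg1.
case/lastP: s => // s a in rs lt_sn y1 s0 nrss *.
case: s => [|b s] in rs lt_sn y1 s0 nrss *.
  by case/negP: nrss; rewrite /= /reduced /= eq_sym letter_inv_neq.
have ab : b = letter_inv a.
  apply/eqP; move: nrss; rewrite (reduced_cat (b :: s) (rcons s a)).
  by rewrite (rs : reduced (b :: rcons s a)) andbT negbK.
have rsa : reduced (rcons s a) := reduced_tail rs.
have rbs : reduced (b :: s).
  by apply: (@reduced_catl _ [:: a]); rewrite cats1.
have rs' : reduced s := reduced_tail rbs.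
have def_y : FreeWord rs =
    free_letter b * FreeWord rs' * (free_letter b)^-1.
  apply: val_inj.
  change (b :: rcons s a = fcat (fcat [:: b] s) [:: letter_inv b]).
  rewrite (@fcat_reduced [:: b] s) // ab letter_invK fcat_reduced cats1 //.
  by rewrite -ab.
have [||g [w [def_s w0 rw]]] := IHn (FreeWord rs').
- by rewrite /= in lt_sn *; rewrite size_rcons in lt_sn; lia.
- by apply: contraNneq y1 => s1; rewrite def_y s1 mulg1 mulgV.
exists (free_letter b * g), w; split=> //.
by rewrite def_y def_s invgM !mulgA.
Qed.

(** After conjugation [y] is cyclically reduced; then [x] and [z], up to
    inversion, commute with it as words, and the claim reduces to the free
    monoid. *)
Theorem free_commute_trans x y z :
  y != 1 -> commute x y -> commute y z -> commute x z.
Proof.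
move=> /cyclic_reduction[g [w [-> w0 rww]]] xy yz.
have conj_comm u : commute u (g * w * g^-1) -> commute (g^-1 * u * g) w.
  rewrite /commute => cu.
  transitivity (g^-1 * (u * (g * w * g^-1)) * g).
    by rewrite !mulgA mulgVK.
  by rewrite cu !mulgA mulVg mul1g.
have [x' x'E x'w] := comm_cyclically_reduced w0 rww (conj_comm x xy).
have [z' z'E z'w] :=
  comm_cyclically_reduced w0 rww (conj_comm z (commute_sym yz)).
have fcatE (s t : freeGroup X) : fcat s t = fcat (fword s ++ t) [::].
  by rewrite /fcat foldr_cat -/(fcat _ _) -/(fcat t _) fcat0 // fwordP.
have xz' : commute x' z'.
  by apply: val_inj; rewrite /= !fcatE (comm_cat_trans w0 x'w z'w).
have unV (u u' v : freeGroup X) :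
    u' = u \/ u' = u^-1 -> commute u' v -> commute u v.
  by case=> -> // /commute_sym/commuteV/commute_sym; rewrite invgK.
have xz : commute (g^-1 * x * g) (g^-1 * z * g).
  apply: (unV _ _ _ x'E); apply/commute_sym; apply: (unV _ _ _ z'E).
  exact/commute_sym.
apply: (mulgI g^-1); apply: (mulIg g).
by move: xz; rewrite /commute !mulgA !mulgK.
Qed.

End CommutationTransitivity.

(** * The Nielsen-Schreier theorem for a spanning tree *)

(** [free_lift act] is a right action of the free group on [Q], since
    permutations compose from left to right.  The function [parent] chooses
    for each vertex other than [q0] the label of an incoming edge of the
    Schreier graph; [rk] decreases along these edges, which therefore form a
    spanning tree rooted at [q0]. *)
Section Schreier.
Local Open Scope group_scope.
Variables (X Q : finType) (act : X -> {perm Q}) (q0 : Q).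
Variables (parent : Q -> X) (rk : Q -> nat).
Hypothesis rk_parent :
  forall q, q != q0 -> rk ((act (parent q))^-1 q) < rk q.

Local Notation walk := (free_lift act).

Definition tree_edge (y : Q * X) :=
  (act y.2 y.1 != q0) && (parent (act y.2 y.1) == y.2).

Definition cotree := {y : Q * X | ~~ tree_edge y}.

(** The tree edges correspond to the vertices other than [q0], through their
    targets. *)
Lemma card_cotree : #|{: cotree}| = (#|Q| * (#|X| - 1) + 1)%N.
Proof.
have Q0 : 0 < #|Q| by apply/card_gt0P; exists q0.
have X0 : 0 < #|X| by apply/card_gt0P; exists (parent q0).
have tree_card : #|[pred y | tree_edge y]| = #|Q|.-1.
  rewrite -(cardC1 q0).
  pose h q := ((act (parent q))^-1 q, parent q).
  have h_inj : injective h.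
    by move=> q q' [hq pq]; rewrite pq in hq; apply: perm_inj hq.
  rewrite -(card_image h_inj); apply: eq_card => -[q x].
  rewrite !inE /tree_edge /=; apply/andP/imageP => /= [[ne /eqP p_x]|[q']].
    by exists (act x q) => //; rewrite /h p_x permK.
  by rewrite inE => ne [-> ->]; rewrite permKV.
rewrite card_sig; have := cardC [pred y | tree_edge y].
rewrite tree_card card_prod.
have -> : #|[predC [pred y | tree_edge y]]| = #|[pred y | ~~ tree_edge y]|.
  by apply: eq_card => y; rewrite !inE.
move: #|[pred y | ~~ tree_edge y]| => k.
case: #|Q| #|X| Q0 X0 => [|m] [|n] // _ _. nia.
Qed.

(** The word [t q] labels the path from [q0] to [q] in the spanning tree. *)
Lemma transversal : exists t : Q -> freeGroup X, t q0 = 1 /\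
  forall q, q != q0 ->
    t q = t ((act (parent q))^-1 q) * free_gen (parent q).
Proof.
(* Recursion on fuel; [rk q] units are enough to reach the root from [q]. *)
pose fix tt (d : nat) (q : Q) {struct d} : freeGroup X :=
  if d is d'.+1 then
    if q == q0 then 1 else
    tt d' ((act (parent q))^-1 q) * free_gen (parent q)
  else 1.
have ttE d q : rk q <= d -> tt d q = tt (rk q) q.
  elim/ltn_ind: d q => d IHd q.
  case: d IHd => [|d] IHd le_qd; first by move: le_qd; rewrite leqn0 => /eqP->.
  have [->|/[dup] q0' /rk_parent lt_q] := eqVneq q q0.
    by rewrite /= eqxx; case: (rk q0) => //= k; rewrite eqxx.
  rewrite /= (negPf q0'); case def_k: (rk q) lt_q le_qd => [|k] //= lt_q le_qd.
  by rewrite (negPf q0') IHd ?(IHd k) //; lia.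
exists (fun q => tt (rk q) q); split=> [|q q0'].
  by case: (rk q0) => //= k; rewrite eqxx.
have lt_q := rk_parent q0'.
case def_k: (rk q) lt_q => [|k] //= lt_q.
by rewrite (negPf q0') ttE.
Qed.

Implicit Types (q : Q) (a : letter X).

Definition edge_val (y : Q * X) : freeGroup cotree :=
  if insub y is Some y' then free_gen y' else 1.

Definition edge q a : freeGroup cotree :=
  if a.2 then (edge_val ((act a.1)^-1 q, a.1))^-1 else edge_val (q, a.1).

Definition step q a := letter_val act a q.

(** The path that starts at [q] and has label [w], read through the edges
    outside the spanning tree.  This cocycle is the rewriting process which
    inverts the Schreier generators on the stabiliser of [q0]. *)
Fixpoint reading q (w : seq (letter X)) : freeGroup cotree :=
  if w is a :: w' then edge q a * reading (step q a) w' else 1.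

Lemma stepK q a : step (step q a) (letter_inv a) = q.
Proof. by rewrite /step letter_valV permK. Qed.

Lemma edgeK q a : edge q a * edge (step q a) (letter_inv a) = 1.
Proof.
case: a => x [] /=; rewrite /edge /step /letter_val /=; first by rewrite mulVg.
by rewrite permK mulgV.
Qed.

Lemma readingM q (u w : freeGroup X) :
  reading q (u * w) = reading q u * reading (walk u q) w.
Proof.
rewrite /= /free_lift; elim: (fword u) q => [|a s IHs] q /=.
  by rewrite mul1g perm1.
rewrite permM -mulgA -/(step q a) -{}IHs; case: (fcat s w) => //= b s'.
by case: ifP => [/eqP->|//]; rewrite mulgA edgeK stepK mul1g.
Qed.

(** The Schreier generator of an edge [(q, x)] outside the tree is
    [t q * x * (t (q x))^-1].  The morphism [k] they define sends [reading q w]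
    to [t q * w * (t (q w))^-1], hence it is onto the stabiliser of [q0];
    conversely [reading q0] is a left inverse of [k], because tree paths are
    read as [1]. *)
Theorem schreier :
  exists k : freeGroup cotree -> freeGroup X,
    [/\ {morph k : u v / u * v}, injective k &
        forall w, (exists v, w = k v) <-> walk w q0 = q0].
Proof.
have [t [t0 t_parent]] := transversal.
pose tg (y : cotree) :=
  t (val y).1 * free_gen (val y).2 * (t (act (val y).2 (val y).1))^-1.
pose k := free_lift tg.
have kM : {morph k : u v / u * v} := free_liftM tg.
have walkM u v q : walk (u * v) q = walk v (walk u q).
  by rewrite free_liftM permM.
have walk_gen x q : walk (free_gen x) q = act x q by rewrite free_lift_gen.
have tree_t q x : tree_edge (q, x) -> t (act x q) = t q * free_gen x.
  by case/andP=> /= q0' /eqP p_x; rewrite t_parent // p_x permK.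
have k_edge_val y : k (edge_val y) = t y.1 * free_gen y.2 * (t (act y.2 y.1))^-1.
  rewrite /edge_val; case: insubP => [y' _ <-|]; first exact: free_lift_gen.
  by rewrite negbK; case: y => q x /tree_t ->; rewrite mulgV.
have k_edge q a : k (edge q a) = t q * free_letter a * (t (step q a))^-1.
  case: a => x []; rewrite /edge /step /letter_val /= ?k_edge_val //.
  rewrite (morph_inv kM) k_edge_val /= permKV !invgM invgK mulgA.
  by congr (_ * _ * _); apply: val_inj.
have k_reading (w : freeGroup X) q : k (reading q w) = t q * w * (t (walk w q))^-1.
  elim/free_ind: w q => [|a w IHw] q.
    by rewrite /= (morph_one (free_liftM act)) perm1 mulg1 mulgV.
  rewrite readingM kM IHw walkM.
  have -> : walk (free_letter a) q = step q a.
    by rewrite /free_lift /= mulg1.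
  by rewrite /= mulg1 k_edge !mulgA mulgVK.
have tP q : walk (t q) q0 = q /\ reading q0 (t q) = 1.
  have [n] := ubnP (rk q); elim: n q => // n IHn q lt_qn.
  have [->|q0'] := eqVneq q q0.
    by rewrite t0 /= (morph_one (free_liftM act)) perm1.
  have [|wq rq] := IHn ((act (parent q))^-1 q).
    exact: leq_trans (rk_parent q0') lt_qn.
  rewrite (t_parent q q0') walkM readingM wq rq mul1g walk_gen permKV.
  split=> //; rewrite /= mulg1 /edge /= /edge_val insubF //.
  by rewrite /tree_edge /= permKV q0' eqxx.
have reading_tV q : reading q (t q)^-1 = 1.
  have [wq rq] := tP q.
  by have := readingM q0 (t q) (t q)^-1; rewrite mulgV wq rq mul1g.
have walk_k v : walk (k v) q0 = q0.
  elim/free_ind: v => [|a v IHv].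
    by rewrite (morph_one kM) (morph_one (free_liftM act)) perm1.
  suff wt : walk (tg a.1) q0 = q0.
    rewrite kM walkM; suff -> : walk (k (free_letter a)) q0 = q0 by [].
    have -> : k (free_letter a) = letter_val tg a by rewrite /k /free_lift /= mulg1.
    rewrite /letter_val; case: a.2 => //.
    by rewrite (morph_inv (free_liftM act)); apply: (canLR (permK _)).
  have [[w1 _] [w2 _]] := (tP (val a.1).1, tP (act (val a.1).2 (val a.1).1)).
  rewrite /tg !walkM w1 walk_gen (morph_inv (free_liftM act)).
  exact: (canLR (permK _)).
have readingK v : reading q0 (k v) = v.
  have rM : {morph (fun u => reading q0 (k u)) : u u' / u * u'}.
    by move=> u u'; rewrite kM readingM walk_k.
  apply: (free_hom_ext rM (g := id)) => // y.
  have [[w1 r1] [w2 _]] := (tP (val y).1, tP (act (val y).2 (val y).1)).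
  rewrite /k free_lift_gen /tg readingM readingM r1 mul1g walkM w1 walk_gen.
  rewrite reading_tV mulg1 /= mulg1 /edge /= -surjective_pairing /edge_val.
  by rewrite valK.
exists k; split=> //; first exact: (can_inj (g := fun w : freeGroup X => reading q0 w)) readingK.
move=> w; split=> [[v ->] //|ww].
by exists (reading q0 w); rewrite k_reading ww t0 invg1 mul1g mulg1.
Qed.

End Schreier.

(** * Second-order Magnus coefficients and the crossed homomorphism *)

Section Heisenberg.
Import GRing.Theory.
Local Open Scope ring_scope.
Variable n : nat.

(** Noncommutative polynomials of the form 1 + linear + quadratic, modulo
    terms of degree 3, under multiplication. *)
Definition heis : Type := ('rV[int]_n * 'M[int]_n)%type.

HB.instance Definition _ := Choice.on heis.

Implicit Types x y z : heis.

Definition heis_one : heis := (0, 0).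
Definition heis_inv x : heis := (- x.1, x.1^T *m x.1 - x.2).
Definition heis_mul x y : heis := (x.1 + y.1, x.2 + y.2 + x.1^T *m y.1).

Fact heis_mulA : associative heis_mul.
Proof.
move=> x y z; rewrite /heis_mul /= addrA; congr (_, _).
rewrite [(_ + _)^T]linearD /= mulmxDl mulmxDr -!addrA; congr (_ + (_ + _)).
by rewrite [RHS]addrCA; congr (_ + _); rewrite addrC -addrA.
Qed.
Fact heis_mul1 : left_id heis_one heis_mul.
Proof. by case=> a c; rewrite /heis_mul /= linear0 mul0mx !add0r addr0. Qed.
Fact heis_mulr1 : right_id heis_one heis_mul.
Proof. by case=> a c; rewrite /heis_mul /= mulmx0 !addr0. Qed.
Fact heis_mulV : left_inverse heis_one heis_inv heis_mul.
Proof.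
case=> a c; rewrite /heis_mul /heis_inv /= addNr subrK linearN /= mulNmx.
by rewrite subrr.
Qed.
Fact heis_mulrV : right_inverse heis_one heis_inv heis_mul.
Proof.
case=> a c; rewrite /heis_mul /heis_inv /= addrN mulmxN [c + _]addrC subrK.
by rewrite addrN.
Qed.

HB.instance Definition _ :=
  isGroup.Build heis heis_mulA heis_mul1 heis_mulr1 heis_mulV heis_mulrV.

Definition magnus : Free n -> heis := free_lift (fun i => (delta_mx 0 i, 0) : heis).

(** The exponent sums of [w], that is, its class in the abelianisation. *)
Definition ab (w : Free n) : 'rV[int]_n := (magnus w).1.
(** Entry [(i, j)] is the coefficient of [X_i X_j] in the Magnus expansion of
    [w].  It is also the coefficient of [X_i] in the Fox derivative of [w] with
    respect to the generator [j], modulo the square of the augmentation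
    ideal. *)
Definition quad (w : Free n) : 'M[int]_n := (magnus w).2.

Lemma abM (u w : Free n) : ab (u * w)%g = ab u + ab w.
Proof. by rewrite /ab /magnus free_liftM. Qed.

Lemma quadM (u w : Free n) :
  quad (u * w)%g = quad u + quad w + (ab u)^T *m ab w.
Proof. by rewrite /quad /magnus free_liftM. Qed.

Lemma ab_gen i : ab (free_gen i) = delta_mx 0 i.
Proof. by rewrite /ab /magnus free_lift_gen. Qed.

Lemma quad_gen i : quad (free_gen i) = 0.
Proof. by rewrite /quad /magnus free_lift_gen. Qed.

Lemma ab1 : ab 1%g = 0. Proof. by []. Qed.
Lemma abV (w : Free n) : ab w^-1%g = - ab w.
Proof. by apply: (addrI (ab w)); rewrite -abM mulgV subrr. Qed.

Lemma quadV (w : Free n) : quad w^-1%g = (ab w)^T *m ab w - quad w.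
Proof.
apply: (addrI (quad w)); apply: (addIr ((ab w)^T *m ab w^-1%g)).
by rewrite -quadM mulgV abV mulmxN [quad w + _]addrC subrK addrN.
Qed.

Lemma ab_surj v : exists w, ab w = v.
Proof.
have ab_big (I : Type) (s : seq I) (F : I -> Free n) :
    ab (\big[mul/1%g]_(i <- s) F i) = \sum_(i <- s) ab (F i).
  exact: (big_morph ab abM ab1).
have ab_exp (w : Free n) k : ab (w ^+ k)%g = k%:Z *: ab w.
  elim: k => [|k IHk]; first by rewrite expg0 ab1 scale0r.
  by rewrite expgS abM IHk -{1}[ab w]scale1r -scalerDl.
exists (\big[mul/1%g]_(i < n)
  if v 0 i is Posz k then (free_gen i : Free n) ^+ k
  else (free_gen i : Free n) ^- `|v 0 i|)%g.
rewrite ab_big [RHS]row_sum_delta; apply: eq_bigr => i _.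
case: (v 0 i) => k; rewrite ?abV ab_exp ab_gen // -scaleNr.
by congr (_ *: _); lia.
Qed.

End Heisenberg.

Section Jacobian.
Import GRing.Theory.
Local Open Scope ring_scope.

Definition jac m n (f : Free m -> Free n) : 'M[int]_(m, n) :=
  \matrix_(i < m) ab (f (free_gen i)).

(** For invertible [f] and [B] the inverse of [jac f]: if [J] is the Fox Jacobian
    of [f] with coefficients in [Z[H]], where [H] is the abelianisation of the
    target and [I] the augmentation ideal, then
    [det J = det (jac f) * (1 + chi f B)] modulo [I^2]. *)
Definition chi m n (f : Free m -> Free n) (B : 'M[int]_(n, m)) : 'cV[int]_n :=
  \sum_(i < m) quad (f (free_gen i)) *m col i B.

Variables (m n : nat) (f : Free m -> Free n).
Hypothesis fM : {morph f : x y / (x * y)%g}.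

(** The right-hand sides define a morphism of Heisenberg groups, so it is
    enough to compare on generators. *)
Lemma ab_quad_hom w :
  ab (f w) = ab w *m jac f /\
  quad (f w) = (jac f)^T *m quad w *m jac f +
    \sum_(i < m) ab w 0 i *: quad (f (free_gen i)).
Proof.
pose g (x : Free m) : heis n := (ab x *m jac f, (jac f)^T *m quad x *m jac f +
    \sum_(i < m) ab x 0 i *: quad (f (free_gen i))).
suff: magnus (f w) = g w by rewrite /ab /quad => ->.
move: w; apply: free_hom_ext => [u w|u w|i].
- by rewrite fM /magnus free_liftM.
- rewrite /g abM quadM mulmxDl; congr (_, _); rewrite /=.
  rewrite !mulmxDr !mulmxDl trmx_mul !mulmxA.
  under eq_bigr do rewrite mxE scalerDl.
  rewrite big_split /= -!addrA; congr (_ + _).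
  by rewrite [RHS]addrCA; congr (_ + _); rewrite addrC -addrA.
rewrite /g ab_gen quad_gen mulmx0 mul0mx add0r -rowE rowK.
rewrite (bigD1 i) //= big1 ?addr0 => [|j /negPf ji]; last first.
  by rewrite mxE eqxx ji scale0r.
by rewrite mxE !eqxx scale1r /ab /quad -surjective_pairing.
Qed.

Lemma ab_hom w : ab (f w) = ab w *m jac f.
Proof. by case: (ab_quad_hom w). Qed.

Lemma jac_comp l (g : Free l -> Free m) : jac (f \o g) = jac g *m jac f.
Proof. by apply/row_matrixP => i; rewrite row_mul !rowK ab_hom. Qed.

(** The crossed homomorphism property, which reflects the chain rule for Fox
    derivatives and the multiplicativity of the determinant. *)
Lemma chi_comp l (g : Free l -> Free m) (B : 'M_(n, m)) (D : 'M_(m, l)) :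
    jac f *m B = 1%:M -> D *m jac g = 1%:M ->
  chi (f \o g) (B *m D) = (jac f)^T *m chi g D + chi f B.
Proof.
move=> fB Dg; rewrite /chi mulmx_sumr.
transitivity (\sum_(i < l) ((jac f)^T *m quad (g (free_gen i)) *m jac f +
   \sum_(j < m) jac g i j *: quad (f (free_gen j))) *m col i (B *m D)).
  apply: eq_bigr => i _; rewrite /= (ab_quad_hom _).2; congr ((_ + _) *m _).
  by apply: eq_bigr => j _; rewrite mxE.
under eq_bigr do rewrite mulmxDl.
rewrite big_split /=; congr (_ + _).
  apply: eq_bigr => i _.
  by rewrite !colE !mulmxA -(mulmxA _ (jac f)) fB mulmx1.
under eq_bigr do rewrite mulmx_suml.
rewrite exchange_big /=; apply: eq_bigr => j _.
under eq_bigr do rewrite -scalemxAl scalemxAr.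
rewrite -mulmx_sumr; congr (_ *m _).
have -> : col j B = B *m D *m col j (jac g).
  by rewrite [col j (jac g)]colE mulmxA -(mulmxA B) Dg mulmx1 colE.
rewrite -[RHS]trmxK [in RHS]trmx_mul mulmx_sum_row linear_sum /=.
by apply: eq_bigr => i _; rewrite linearZ /= tr_row trmxK !mxE.
Qed.

End Jacobian.

Section ChiInner.
Import GRing.Theory.
Local Open Scope ring_scope.
Variable n : nat.

Lemma jac_id : jac (id : Free n -> Free n) = 1%:M.
Proof. by apply/row_matrixP => i; rewrite rowK row1 ab_gen. Qed.

Lemma chi_id B : chi (id : Free n -> Free n) B = 0.
Proof. by rewrite /chi big1 // => i _; rewrite quad_gen mul0mx. Qed.

Lemma jac_conj (g : Free n) : jac (fun x : Free n => (g * x * g^-1)%g) = 1%:M.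
Proof.
apply/row_matrixP => i; rewrite rowK row1 !abM abV ab_gen.
by rewrite addrC addKr.
Qed.

(** Conjugation by [g] sends the generator [i] to an element with second-order
    part [a^T e_i - e_i^T a], where [a] is the class of [g].  The trace of the
    first term gives [n a], that of the second one gives [a]. *)
Lemma chi_conj (g : Free n) :
  chi (fun x : Free n => (g * x * g^-1)%g) 1%:M = (n%:Z - 1) *: (ab g)^T.
Proof.
have termE i : quad (g * free_gen i * g^-1)%g *m col i 1%:M =
    (ab g)^T - ab g 0 i *: (delta_mx 0 i)^T.
  have -> : quad (g * free_gen i * g^-1)%g =
      (ab g)^T *m delta_mx 0 i - (delta_mx 0 i)^T *m ab g.
    rewrite !quadM quad_gen quadV abM abV ab_gen linearD /= mulmxDl !mulmxN.
    move: (quad g) ((ab g)^T *m ab g) (_ *m delta_mx 0 i) (_^T *m ab g).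
    by move=> A B C D; apply/matrixP => k l; rewrite !mxE; ring.
  rewrite mulmxBl -!mulmxA col1 mul_delta_mx -(colE i (ab g)).
  rewrite [col i _]mx11_scalar [delta_mx 0 0]mx11_scalar !mul_mx_scalar !mxE.
  by rewrite !eqxx scale1r.
rewrite /chi (eq_bigr _ (fun i _ => termE i)) sumrB sumr_const card_ord.
rewrite scalerBl scale1r -natz scaler_nat; congr (_ - _).
by rewrite {2}[ab g]row_sum_delta linear_sum; apply: eq_bigr => i _; rewrite linearZ.
Qed.

End ChiInner.

Section Rank.
Import GRing.Theory.
Local Open Scope ring_scope.

Lemma int_mx_rank m n (A : 'M[int]_(m, n)) (B : 'M[int]_(n, m)) :
  A *m B = 1%:M -> (m <= n)%N.
Proof.
move=> /(congr1 (map_mx (intr : int -> rat))).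
rewrite map_mxM map_mx1 => AB.
have := mxrankM_maxl (map_mx intr A) (map_mx (intr : int -> rat) B).
by rewrite AB mxrank1 => /leq_trans; apply; apply: rank_leq_col.
Qed.

End Rank.

(** * The congruence subgroup of a free group *)

Section Relabel.
Local Open Scope group_scope.

Lemma free_relabel (X Y : choiceType) (h : X -> Y) : bijective h ->
  exists k : freeGroup X -> freeGroup Y,
    {morph k : u v / u * v} /\ bijective k.
Proof.
case=> h' hK h'K.
pose k := free_lift (fun x => free_gen (h x)).
pose k' := free_lift (fun y => free_gen (h' y)).
exists k; split; first exact: free_liftM.
exists k'.
  apply: (free_hom_ext (f := k' \o k) (g := id)) => // [u v|x].
    by rewrite /= /k /k' !free_liftM.
  by rewrite /= /k free_lift_gen /k' free_lift_gen hK.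
apply: (free_hom_ext (f := k \o k') (g := id)) => // [u v|x].
  by rewrite /= /k /k' !free_liftM.
by rewrite /= /k' free_lift_gen /k free_lift_gen h'K.
Qed.

End Relabel.

Section Congruence.
Import GRing.Theory.
Local Open Scope ring_scope.

(** The kernel of the map to [(Z/r)^n]. *)
Definition cong (n r : nat) (w : Free n) : Prop :=
  forall i, (r%:Z %| ab w ord0 i)%Z.

Section Cover.
Variables (n r' : nat).
Local Notation r := r'.+1.
Local Notation Q := {ffun 'I_n -> 'I_r}.

(** Reduction modulo [r]; only the additive group of ['I_r] is used, so that
    [r = 1] needs no special treatment. *)
Definition mod_int (k : int) : 'I_r := inZp 1 *~ k.

Lemma mod_int_eq0 k : (mod_int k == 0) = (r%:Z %| k)%Z.
Proof.
have natE m : (inZp 1 *+ m : 'I_r) = inZp m.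
  elim: m => [|m IHm]; first exact: val_inj.
  rewrite mulrS IHm; apply: val_inj => /=.
  by rewrite modnDml modnDmr.
have nat0 m : ((inZp 1 *+ m : 'I_r) == 0) = (r %| m)%N.
  by rewrite natE -val_eqE.
rewrite /mod_int; case: k => m.
  by rewrite -pmulrn nat0.
by rewrite NegzE mulrNz oppr_eq0 -pmulrn nat0.
Qed.

Definition mod_row (v : 'rV[int]_n) : Q := [ffun j => mod_int (v 0 j)].

Lemma mod_rowD u v : mod_row (u + v) = mod_row u + mod_row v.
Proof. by apply/ffunP => j; rewrite !ffunE mxE /mod_int mulrzDr. Qed.

Definition translation (q : Q) : {perm Q} := perm (addIr q).

Definition cover_act (x : 'I_n) : {perm Q} := translation (mod_row (delta_mx 0 x)).

Lemma cover_walk (w : Free n) : free_lift cover_act w = translation (mod_row (ab w)).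
Proof.
move: w; apply: free_hom_ext => [|u v|x]; first exact: free_liftM.
  by apply/permP => q; rewrite permM !permE abM mod_rowD addrA.
by rewrite free_lift_gen ab_gen.
Qed.

End Cover.

(** Schreier's theorem for the translation action on [(Z/r)^n].  The spanning
    tree decreases some nonzero coordinate, so the sum of the coordinates is a
    rank function. *)
Theorem cong_free n r : (0 < n)%N -> (0 < r)%N ->
  exists k : Free (r ^ n * (n - 1) + 1) -> Free n,
    [/\ {morph k : u v / (u * v)%g}, injective k &
        forall w, (exists v, w = k v) <-> cong r w].
Proof.
move=> n0; case: r => // r' _; set r := r'.+1.
pose Q := {ffun 'I_n -> 'I_r}.
pose parent (q : Q) : 'I_n := odflt (Ordinal n0) [pick j | q j != 0].
pose rk (q : Q) := (\sum_j q j)%N.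
have rk_parent q : q != 0 -> (rk ((@cover_act n r' (parent q))^-1%g q) < rk q)%N.
  move=> q0; set j := parent q.
  have qj : q j != 0.
    rewrite /j /parent; case: pickP => //= q_eq0.
    by case/eqP: q0; apply/ffunP => i; rewrite ffunE; apply/eqP/negbFE/q_eq0.
  (* Removing one unit from the nonzero coordinate [j] does not wrap around. *)
  set q' := _ q; have def_q : q = @cover_act n r' j q' by rewrite permKV.
  have q'E i : i != j -> q i = q' i.
    rewrite def_q permE !ffunE mxE /= => /negPf->.
    by rewrite ?andbF /mod_int mulr0z addr0.
  have q'j : (q j : nat) = (q' j).+1.
    move: qj; rewrite def_q permE !ffunE mxE !eqxx /mod_int mulr1z -val_eqE /=.
    rewrite modnDmr addn1; have := ltn_ord (q' j).
    by rewrite leq_eqVlt => /orP[/eqP->|/modn_small->//]; rewrite modnn.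
  rewrite /rk (bigD1 j) //= [ltnRHS](bigD1 j) //= q'j addSn ltnS leq_add2l.
  by rewrite leq_eqVlt; apply/orP/or_introl/eqP/eq_bigr => i /q'E ->.
have [k [kM k_inj k_im]] := schreier rk_parent.
have := @card_cotree _ _ (@cover_act n r') 0 parent; rewrite card_ffun !card_ord => card_Y.
have [k' [k'M k'_bij]] := free_relabel (enum_val_bij {: cotree (@cover_act n r') 0 parent}).
rewrite -card_Y; exists (k \o k'); split.
- by move=> u v; rewrite /= k'M kM.
- by apply: inj_comp => //; apply: bij_inj.
move=> w; apply: (iff_trans (B := exists v, w = k v)).
  split=> [[v ->]|[v ->]]; first by exists (k' v).
  by case: k'_bij => k1 k'K k1K; exists (k1 v); rewrite /= k1K.
apply: (iff_trans (k_im w)); rewrite cover_walk permE add0r.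
split=> [/ffunP w0 i|w0].
  by rewrite -mod_int_eq0; have := w0 i; rewrite !ffunE => ->.
by apply/ffunP => i; rewrite !ffunE; apply/eqP; rewrite mod_int_eq0.
Qed.

Lemma cong_hom m n r (f : Free m -> Free n) w :
  {morph f : u v / (u * v)%g} -> cong r w -> cong r (f w).
Proof.
move=> fM rw i; rewrite ab_hom // mxE; apply: rpred_sum => j _.
exact: dvdz_mulr.
Qed.

End Congruence.

(** * Embeddings between outer automorphism groups *)

(** The subgroup [S] of [Aut G] surjects onto [Out G], stabilises the image of
    [k] and contains no inner automorphism besides the conjugations by elements
    of this image. *)
Section OutEmbedding.
Local Open Scope group_scope.

Fact is_aut_conj (G : groupType) (g : G) : is_aut (fun x => g * x * g^-1).
Proof.
split; last by move=> x y; rewrite !mulgA mulgVK.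
by exists (fun x => g^-1 * x * g) => x; rewrite !mulgA ?mulVg ?mulgV mul1g
  ?mulgK ?mulgVK.
Qed.

Definition inner (G : groupType) (g : G) : Aut G :=
  MkAut (asboolT (is_aut_conj g)).

Lemma innerE (G : groupType) (g x : G) : inner g x = g * x * g^-1.
Proof. by []. Qed.

Lemma inner_Inn (G : groupType) (g : G) : inner g \in @Inn G.
Proof. by apply/InnP; exists g. Qed.

Variables (G H : groupType) (k : H -> G) (S : Aut G -> Prop).
Hypotheses (kM : {morph k : x y / x * y}) (k_inj : injective k).
Hypotheses (SM : forall f g, S f -> S g -> S (f * g)) (SV : forall f, S f -> S f^-1).
Hypothesis S_stable : forall f, S f -> forall y, exists y', f (k y) = k y'.
Hypothesis S_cover : forall f, exists g, S (inner g * f).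
Hypothesis S_inner : forall g, S (inner g) -> exists y, g = k y.
Hypothesis k_faithful : forall f : Aut G, (forall y, f (k y) = k y) -> f = 1.

Let restricts (f : Aut G) (h : Aut H) := forall y, k (h y) = f (k y).

Lemma restriction f : S f -> exists h, restricts f h.
Proof.
move=> Sf.
have /choice[h hE] := S_stable Sf; have /choice[h' h'E] := S_stable (SV Sf).
have aut_h : is_aut h.
  split; last by move=> x y; apply: k_inj; rewrite kM -!hE kM autM.
  exists h' => y; apply: k_inj; first by rewrite -h'E -hE autKV.
  by rewrite -hE -h'E autVK.
by exists (MkAut (asboolT aut_h)) => y; rewrite /= -hE.
Qed.

Lemma restrictsM f f' h h' :
  restricts f h -> restricts f' h' -> restricts (f * f') (h * h').
Proof. by move=> fh fh' y; rewrite !autEM fh fh'. Qed.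

Lemma restrictsV f h : restricts f h -> restricts f^-1 h^-1.
Proof. by move=> fh y; apply: (can_inj (autKV f)); rewrite -fh !autVK. Qed.

(** If [f] restricts to conjugation by [y], then it differs from conjugation by
    [k y] by an automorphism fixing the image of [k], hence trivial. *)
Lemma restricts_Inn f h : S f -> restricts f h -> (f \in @Inn G) = (h \in @Inn H).
Proof.
move=> Sf fh; apply/InnP/InnP => [[g fE]|[y hE]].
  have [y gE] : exists y, g = k y.
    by apply: S_inner; rewrite -(_ : f = inner g) //; apply: aut_eq.
  exists y => x; apply: k_inj.
  by rewrite fh fE !kM (morph_inv kM) gE.
exists (k y); suff -> : f = inner (k y) by [].
apply: (mulgI (inner (k y))^-1); rewrite mulVg; apply: k_faithful => x.
rewrite autEM -fh hE !kM (morph_inv kM).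
by apply: (can_inj (autKV (inner (k y)))); rewrite autVK.
Qed.

(** Send the class of [f] in [S] to the class of its restriction; both the
    independence of the choice of [f] and injectivity are [restricts_Inn]. *)
Theorem out_embedding :
  exists phi : Multiplicative.type (Out G) (Out H), injective phi.
Proof.
have /choice[p pP] (c : Out G) : exists p : Aut G * Aut H,
    [/\ S p.1, out_pi p.1 = c & restricts p.1 p.2].
  have [f <-] : exists f, out_pi f = c := ex_intro _ _ (out_reprK c).
  have [g Sg] := S_cover f; have [h hP] := restriction Sg.
  exists (inner g * f, h); split=> //=; apply/out_piP.
  by rewrite invgM -mulgA -conjgE InnJ // gpredV inner_Inn.
have out_eq f f' h h' : S f -> S f' -> restricts f h -> restricts f' h' ->
    out_pi f = out_pi f' <-> out_pi h = out_pi h'.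
  move=> Sf Sf' fh fh'.
  have E := restricts_Inn (SM (SV Sf) Sf') (restrictsM (restrictsV fh) fh').
  by split=> /out_piP; [rewrite E|rewrite -E] => /out_piP.
pose phi c := out_pi (p c).2.
have phiM : {morph phi : c d / c * d}.
  move=> c d; have [[Sc pc rc] [Sd pd rd]] := (pP c, pP d).
  have [Scd pcd rcd] := pP (c * d).
  rewrite /phi -[RHS](out_piM (p c).2 (p d).2).
  apply: (out_eq _ _ _ _ Scd (SM Sc Sd) rcd (restrictsM rc rd)).1.
  by rewrite pcd [RHS]out_piM pc pd.
exists (HB.pack_for (Multiplicative.type (Out G) (Out H)) phi
  (isMultiplicative.Build _ _ phi phiM)).
move=> c d; have [[Sc pc rc] [Sd pd rd]] := (pP c, pP d).
by move/(out_eq _ _ _ _ Sc Sd rc rd).2; rewrite pc pd.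
Qed.

End OutEmbedding.

Section OutIso.
Local Open Scope group_scope.

Lemma out_iso (G H : groupType) (k : H -> G) :
    {morph k : x y / x * y} -> bijective k ->
  exists phi : Multiplicative.type (Out G) (Out H), injective phi.
Proof.
move=> kM [k' kK k'K]; apply: (@out_embedding _ _ k (fun=> True)) => //.
- exact: can_inj kK.
- by move=> f _ y; exists (k' (f (k y))); rewrite k'K.
- by exists 1.
- by move=> g _; exists (k' g); rewrite k'K.
by move=> f fk; apply: aut_eq => x; rewrite -[x]k'K fk.
Qed.

Lemma out_comp (G H K : groupType) :
    (exists phi : Multiplicative.type (Out G) (Out H), injective phi) ->
    (exists phi : Multiplicative.type (Out H) (Out K), injective phi) ->
  exists phi : Multiplicative.type (Out G) (Out K), injective phi.
Proof.
by case=> f f_inj [g g_inj]; exists (g \o f); apply: inj_comp.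
Qed.

End OutIso.

(** * Automorphisms of products of nonabelian groups with transitive commutation *)

(** The list [s] enumerates [J], that is, the product has finitely many
    factors. *)
Section ProductAut.
Local Open Scope group_scope.
Variables (J : eqType) (s : seq J) (G : J -> groupType).
Hypothesis s_all : forall a, a \in s.
Hypothesis commute_trans : forall a (x y z : G a),
  y != 1 -> commute x y -> commute y z -> commute x z.
Hypothesis nonabelian : forall a, exists x y : G a, ~ commute x y.

Local Notation P := (dirprod G).
Implicit Types (g : P) (f h : Aut P) (a b c : J).

Lemma dirprodE g g' a : (g * g') a = g a * g' a. Proof. by []. Qed.
Lemma dirprodV g a : g^-1 a = (g a)^-1. Proof. by []. Qed.

Lemma dirprodP g g' : (forall a, g a = g' a) -> g = g'.
Proof. exact: functional_extensionality_dep. Qed.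

Definition update g a (x : G a) : P := @dfwith J (fun b => G b) g a x.

Lemma update_in g a (x : G a) : update g x a = x.
Proof. exact: dfwith_in. Qed.

Lemma update_out g a (x : G a) b : a != b -> update g x b = g b.
Proof. exact: dfwith_out. Qed.

Definition incl a (x : G a) : P := update 1 x.

Lemma incl_in a (x : G a) : incl x a = x. Proof. exact: update_in. Qed.

Lemma incl_out a (x : G a) b : a != b -> incl x b = 1.
Proof. exact: update_out. Qed.

Lemma inclM a : {morph @incl a : x y / x * y}.
Proof.
move=> x y; apply: dirprodP => b; rewrite dirprodE.
have [<-|ab] := eqVneq a b; first by rewrite !incl_in.
by rewrite !incl_out // mulg1.
Qed.

Lemma dirprod_split g a :
  g = incl (g a) * update g (1 : G a) /\
  g = update g (1 : G a) * incl (g a).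
Proof.
split; apply: dirprodP => b; rewrite dirprodE; have [<-|ab] := eqVneq a b;
  by rewrite ?incl_in ?update_in ?incl_out ?update_out ?mulg1 ?mul1g.
Qed.

Definition entry f a b (x : G a) : G b := f (incl x) b.
Arguments entry : clear implicits.

Lemma entryM f a b : {morph entry f a b : x y / x * y}.
Proof. by move=> x y; rewrite /entry inclM autM. Qed.

Definition depends f a b := forall g, f g b = entry f a b (g a).

(** Finiteness of [J] enters here: otherwise the morphism [g |-> f g b] could be
    trivial on every factor without being trivial. *)
Lemma nontrivial_entry f b : exists a (x : G a), entry f a b x != 1.
Proof.
apply: contrapT => no_entry.
have triv a (x : G a) : f (incl x) b = 1.
  by apply: contrapT => /eqP ne; apply: no_entry; exists a, x.
have f1 (l : seq J) g : (forall a, a \notin l -> g a = 1) -> f g b = 1.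
  elim: l g => [|a l IHl] g g1.
    have -> : g = 1 by apply: dirprodP => a; apply: g1.
    by rewrite (morph_one (autM f)).
  have [-> _] := dirprod_split g a; rewrite autM dirprodE triv mul1g.
  apply: IHl => c cl; have [<-|ac] := eqVneq a c; first by rewrite update_in.
  by rewrite update_out // g1 // inE negb_or eq_sym ac.
have [x [y]] := nonabelian b; apply.
have x1 (z : G b) : z = 1.
  rewrite -[z]incl_in -(autVK f (incl z)).
  by apply: (f1 s) => a; rewrite s_all.
by rewrite (x1 x) (x1 y).
Qed.

(** Suppose that [f] sends the factor [a] nontrivially to the factor [b], say
    with a value [X], and that it also sends an element whose coordinate [a] is
    trivial to some nontrivial [Y].  Images of the factor [a] commute with [Y],
    images of the complementary factors commute with [X], and [X] commutes with
    [Y]; by transitivity everything commutes with [X], so the factor [b] is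
    abelian. *)
Lemma depends_ex f b : exists a, depends f a b.
Proof.
have [a [x ex]] := nontrivial_entry f b; exists a => g.
have [gE _] := dirprod_split g a.
suff f1 : f (update g (1 : G a)) b = 1.
  by rewrite {1}gE autM dirprodE f1 mulg1.
apply: contrapT => /eqP f1; set g' : P := update _ _ in f1.
have comm_a (z : G a) g0 : commute (entry f a b z) (f (update g0 (1 : G a)) b).
  rewrite /commute /entry -!dirprodE -!autM; congr (f _ b).
  apply: dirprodP => c; rewrite !dirprodE.
  have [<-|ac] := eqVneq a c; first by rewrite update_in mulg1 mul1g.
  by rewrite incl_out // mulg1 mul1g.
have comm_x g0 : commute (f g0 b) (entry f a b x).
  have [-> _] := dirprod_split g0 a; rewrite autM dirprodE.
  apply/commute_sym/commuteM; last exact: comm_a.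
  apply: (commute_trans f1); first exact: comm_a.
  exact/commute_sym/comm_a.
have [y [z]] := nonabelian b; apply.
rewrite -[y]incl_in -[z]incl_in -(autVK f (incl y)) -(autVK f (incl z)).
apply: (commute_trans ex); first exact: comm_x.
exact/commute_sym/comm_x.
Qed.

Lemma depends_uniq f a a' b : depends f a b -> depends f a' b -> a = a'.
Proof.
move=> fa fa'; apply/eqP; apply: contrapT => /negP aa'.
have [y [z]] := nonabelian b; apply.
have x1 (x : G b) : x = 1.
  rewrite -[x]incl_in -(autVK f (incl x)) fa /entry fa' incl_out //.
  by rewrite (morph_one (@entryM _ _ _)).
by rewrite (x1 y) (x1 z).
Qed.

Lemma entry_comp f h a b c (x : G a) :
  depends f b c -> entry (f * h) a c x = entry f b c (entry h a b x).
Proof. by move=> fbc; rewrite {1}/entry autEM fbc. Qed.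

Lemma depends_comp f h a b c :
  depends f b c -> depends h a b -> depends (f * h) a c.
Proof.
by move=> fbc hab g; rewrite (entry_comp _ _ fbc) autEM fbc hab.
Qed.

Lemma depends_inner (x : P) b : depends (inner x) b b.
Proof. by move=> g; rewrite /entry !innerE !dirprodE incl_in. Qed.

Lemma entry_inner (x : P) b (y : G b) :
  entry (inner x) b b y = x b * y * (x b)^-1.
Proof. by rewrite /entry innerE !dirprodE incl_in. Qed.

Lemma depends_id b : depends 1 b b.
Proof. by move=> g; rewrite /entry !autE1 incl_in. Qed.

Lemma entry_id b (x : G b) : entry 1 b b x = x.
Proof. by rewrite /entry autE1 incl_in. Qed.

Lemma depends_inv f a b : depends f a b -> depends f^-1 b a.
Proof.
move=> fab; have [c fca] := depends_ex f^-1 a.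
have := depends_comp fab fca; rewrite mulgV => /depends_uniq/(_ (depends_id b)) <-.
exact: fca.
Qed.

Lemma entryK f a b (x : G a) : depends f a b -> entry f^-1 b a (entry f a b x) = x.
Proof.
by move=> fab; rewrite -(entry_comp _ _ (depends_inv fab)) mulVg entry_id.
Qed.

End ProductAut.

Arguments entry [J G] f a b x.

(** * Products of free groups *)

Lemma free_nonabelian n : 2 <= n -> exists x y : Free n, ~ commute x y.
Proof.
move=> n2; pose i0 := Ordinal (ltnW n2); pose i1 := Ordinal n2.
by exists (free_gen i0), (free_gen i1); apply: free_gen_noncomm.
Qed.

Section FreeProduct.
Import GRing.Theory.
Local Open Scope ring_scope.
Variables (J : eqType) (s : seq J) (dim : J -> nat) (r : nat -> nat).
Hypotheses (s_all : forall a, a \in s) (dim_ge2 : forall a, (2 <= dim a)%N).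
Hypothesis r_gt0 : forall a, (0 < r (dim a))%N.
Hypothesis r_coprime : forall a, coprime (dim a - 1) (r (dim a)).

Local Notation G a := (Free (dim a)).
Local Notation P := (dirprod (fun a => G a)).
Implicit Types (f h : Aut P) (a b c : J) (g x : P).

Let commute_trans a (x y z : G a) :
  y != 1%g -> commute x y -> commute y z -> commute x z.
Proof. exact: free_commute_trans. Qed.

Let nonabelian a : exists x y : G a, ~ commute x y.
Proof. exact: free_nonabelian. Qed.

Let dep_ex := depends_ex s_all commute_trans nonabelian.
Let dep_uniq f a a' b := @depends_uniq J (fun a => G a) nonabelian f a a' b.
Let dep_inv f a b := @depends_inv J s _ s_all commute_trans nonabelian f a b.
Let entry_cancel f a b := @entryK J s _ s_all commute_trans nonabelian f a b.

Let entry_morph f a b : {morph (entry f a b : G a -> G b) : x y / (x * y)%g}.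
Proof. exact: (@entryM J (fun a => G a)). Qed.

Lemma jac_entry f a b : depends f a b ->
  jac (entry f a b) *m jac (entry f^-1%g b a) = 1%:M.
Proof.
move=> fab; rewrite -jac_comp; last exact: entry_morph.
rewrite -[RHS]jac_id; congr jac; apply: funext => x /=.
exact: entry_cancel.
Qed.

Lemma jac_entryV f a b : depends f a b ->
  jac (entry f^-1%g b a) *m jac (entry f a b) = 1%:M.
Proof. by move=> /dep_inv/jac_entry; rewrite invgK. Qed.

(** The two Jacobians are inverse integral matrices. *)
Lemma depends_dim f a b : depends f a b -> dim a = dim b.
Proof.
move=> fab; apply/eqP; rewrite eqn_leq.
by rewrite (int_mx_rank (jac_entry fab)) (int_mx_rank (jac_entryV fab)).
Qed.

Definition crossed f a b : 'cV[int]_(dim b) :=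
  chi (entry f a b) (jac (entry f^-1%g b a)).

Lemma crossedM f h a b c : depends f b c -> depends h a b ->
  crossed (f * h)%g a c = (jac (entry f b c))^T *m crossed h a b + crossed f b c.
Proof.
move=> fbc hab; rewrite /crossed invgM.
have -> : entry (f * h)%g a c = entry f b c \o entry h a b.
  by apply: funext => x; rewrite (entry_comp _ _ fbc).
have -> : entry (h^-1 * f^-1)%g c a = entry h^-1%g b a \o entry f^-1%g c b.
  by apply: funext => x; rewrite (entry_comp _ _ (dep_inv hab)).
rewrite jac_comp; last exact: entry_morph.
apply: chi_comp; [exact: entry_morph | exact: jac_entry | exact: jac_entryV].
Qed.

Lemma entry_innerE (x : P) b :
  entry (inner x) b b = (fun y : G b => x b * y * (x b)^-1)%g.
Proof. by apply: funext => y; rewrite entry_inner. Qed.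

Lemma crossed_inner (x : P) b :
  crossed (inner x) b b = ((dim b)%:Z - 1) *: (ab (x b))^T.
Proof.
have := jac_entry (depends_inner x b).
rewrite /crossed entry_innerE jac_conj mul1mx => ->; exact: chi_conj.
Qed.

Lemma crossed_id b : crossed 1%g b b = 0.
Proof.
rewrite /crossed (_ : entry 1%g b b = id) ?chi_id //.
by apply: funext => y; rewrite /entry autE1 incl_in.
Qed.

(** The subgroup which lifts the outer automorphism group up to conjugations by
    the congruence subgroup. *)
Definition split_aut f := forall a b, depends f a b ->
  forall i, ((r (dim b))%:Z %| crossed f a b i ord0)%Z.

Lemma dvdz_mulmx m n d (A : 'M[int]_(m, n)) (v : 'cV[int]_n) :
    (forall i, (d %| v i ord0)%Z) -> forall i, (d %| (A *m v) i ord0)%Z.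
Proof.
by move=> dv i; rewrite mxE; apply: rpred_sum => j _; apply: dvdz_mull.
Qed.

Lemma split_autM f h : split_aut f -> split_aut h -> split_aut (f * h)%g.
Proof.
move=> Sf Sh a c fhac i; have [b fbc] := dep_ex f c.
have [a' ha'b] := dep_ex h b.
rewrite -(dep_uniq (depends_comp fbc ha'b) fhac) (crossedM fbc ha'b) mxE.
apply: rpredD; last exact: Sf.
by apply: dvdz_mulmx; rewrite -(depends_dim fbc); apply: Sh.
Qed.

(** From [0 = crossed 1 = crossed (f^-1 * f)] and the crossed property. *)
Lemma split_autV f : split_aut f -> split_aut f^-1%g.
Proof.
move=> Sf b a fVba i; have := dep_inv fVba; rewrite invgK => fab.
have := crossedM fVba fab; rewrite mulVg crossed_id.
move/esym/eqP; rewrite addrC addr_eq0 => /eqP->; rewrite mxE rpredN.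
by apply: dvdz_mulmx; rewrite (depends_dim fab); apply: Sf.
Qed.

(** Composing with conjugation by [g] adds [(n - 1) [g_b]] to the value at [b],
    and [n - 1] is invertible modulo [r]. *)
Lemma split_aut_cover f : exists g, split_aut (inner g * f)%g.
Proof.
have adjust b : exists w : G b, forall a, depends f a b -> forall i,
    ((r (dim b))%:Z %| (((dim b)%:Z - 1) *: (ab w)^T + crossed f a b) i ord0)%Z.
  have [a fab] := dep_ex f b.
  have [u [v uv]] : exists u v : int, u * ((dim b)%:Z - 1) + v * (r (dim b))%:Z = 1.
    have /coprimezP[[u v] /= uv] : coprimez (dim b - 1)%N (r (dim b)).
      exact: r_coprime.
    exists u, v; rewrite -uv; congr (_ * _ + _).
    by have := dim_ge2 b; lia.
  have [w abw] := ab_surj (- u *: (crossed f a b)^T).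
  exists w => a' /(dep_uniq fab) <- i; rewrite abw.
  rewrite !mxE.
  have -> (X : int) : ((dim b)%:Z - 1) * (- u * X) + X = X * (v * (r (dim b))%:Z).
    by rewrite (canRL (addKr _) uv); ring.
  by rewrite mulrA dvdz_mull.
have {}adjust b := cid (adjust b).
pose g : P := fun b => sval (adjust b).
exists g => a b gfab i; have [a' fab] := dep_ex f b.
rewrite -(dep_uniq (depends_comp (depends_inner g b) fab) gfab).
rewrite (crossedM (depends_inner g b) fab).
rewrite entry_innerE jac_conj trmx1 mul1mx crossed_inner addrC.
exact: (svalP (adjust b)).
Qed.

(** Here [r] divides [(n - 1) [g_b]], hence [[g_b]]. *)
Lemma split_aut_inner (g : P) b : split_aut (inner g) -> cong (r (dim b)) (g b).
Proof.
move=> Sg i; have := Sg b b (depends_inner g b) i.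
rewrite crossed_inner !mxE Gauss_dvdzr // coprimez_sym.
have := r_coprime b; rewrite -[coprime _ _]/(coprimez (dim b - 1)%N (r (dim b))).
by have -> : (dim b - 1)%N%:Z = (dim b)%:Z - 1 by have := dim_ge2 b; lia.
Qed.

(** This is where it matters that [r] is a function of the rank: the two factors
    linked by [depends] have the same rank, hence the same modulus. *)
Lemma aut_cong f g : (forall a, cong (r (dim a)) (g a)) ->
  forall b, cong (r (dim b)) (f g b).
Proof.
move=> rg b; have [a fab] := dep_ex f b.
rewrite fab; apply: cong_hom; first exact: entry_morph.
by rewrite -(depends_dim fab); apply: rg.
Qed.

Local Notation cover_dim a := (r (dim a) ^ dim a * (dim a - 1) + 1)%N.
Local Notation H := (dirprod (fun a => Free (cover_dim a))).

Theorem out_free_product :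
  exists phi : Multiplicative.type (Out P) (Out H), injective phi.
Proof.
have k_ex a := cid (cong_free (ltnW (dim_ge2 a)) (r_gt0 a)).
pose k a := sval (k_ex a).
have kM a : {morph k a : u v / (u * v)%g} by case: (svalP (k_ex a)).
have k_inj a : injective (k a) by case: (svalP (k_ex a)).
have k_im a w : (exists v, w = k a v) <-> cong (r (dim a)) w.
  by case: (svalP (k_ex a)).
pose K (y : H) : P := fun a => k a (y a).
have K_im (x : P) : (forall a, cong (r (dim a)) (x a)) -> exists y, x = K y.
  move=> rx; have vx a := cid ((k_im a _).2 (rx a)).
  by exists (fun a => sval (vx a)); apply: dirprodP => a; exact: svalP (vx a).
have K_cong (y : H) a : cong (r (dim a)) (K y a) by apply/k_im; exists (y a).
have K_stable f y : exists y', f (K y) = K y'.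
  by apply: K_im; apply: aut_cong => a; apply: K_cong.
have KM : {morph K : u v / (u * v)%g}.
  by move=> u v; apply: dirprodP => a; rewrite /K /= kM.
apply: (@out_embedding P H K split_aut).
- exact: KM.
- move=> u v Kuv; apply: dirprodP => a; apply: (@k_inj a).
  by rewrite -/(K u a) Kuv.
- exact: split_autM.
- exact: split_autV.
- by move=> f _; apply: K_stable.
- exact: split_aut_cover.
- by move=> g Sg; apply: K_im => b; apply: split_aut_inner.
move=> f fK; apply: aut_eq => x; rewrite autE1.
(* Conjugates of elements of the image of [K] are again in this image, hence
fixed by [f]. *)
have comm_K y : commute (x^-1 * f x)%g (K y).
  have [y' xy] := K_stable (inner x) y.
  have := fK y'; rewrite -xy innerE !autM fK (morph_inv (@autM _ f)) => E.
  rewrite /commute; apply: (mulgI x); apply: (mulIg (f x)^-1%g).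
  by rewrite !mulgA mulgV mul1g E mulgK.
apply: dirprodP => b; apply: contrapT => /eqP fxb.
have cb : (x^-1 * f x)%g b != 1%g.
  by apply: contraNneq fxb; rewrite dirprodE dirprodV => E;
    rewrite -[f x b](mulVKg (x b)) E mulg1.
have dim2 : (2 <= cover_dim b)%N.
  have := dim_ge2 b; have : (0 < r (dim b) ^ dim b)%N by rewrite expn_gt0 r_gt0.
  by case: (_ ^ _)%N => // q _; nia.
have [y [z]] := free_nonabelian dim2; apply.
have comm_k (v : Free (cover_dim b)) : commute ((x^-1 * f x)%g b) (k b v).
  have := congr1 (fun g : P => g b) (comm_K (@incl _ (fun a => Free (cover_dim a)) b v)).
  by rewrite /K !dirprodE incl_in.
apply: (@k_inj b); rewrite !kM.
exact: (free_commute_trans cb (commute_sym (comm_k y)) (comm_k z)).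
Qed.

End FreeProduct.

Section ProdFree.
Variables (m e : nat -> nat).

Definition factor : eqType := {i : {i : nat | 2 <= i} & 'I_(e (val i))}.
Definition factor_rank (a : factor) : nat := val (tag a).

Lemma prodFree_dirprod :
  exists k : dirprod (fun a : factor => Free (m (factor_rank a))) -> prodFree m e,
    {morph k : x y / (x * y)%g} /\ bijective k.
Proof.
pose k (x : dirprod (fun a : factor => Free (m (factor_rank a)))) : prodFree m e :=
  fun i => [ffun j => x (Tagged (fun i : {i : nat | 2 <= i} => 'I_(e (val i))) j)].
exists k; split.
  by move=> x y; apply: dirprodP => i; apply/ffunP => j; rewrite !ffunE.
pose h (g : dirprod (fun i : {i : nat | 2 <= i} =>
      {ffun 'I_(e (val i)) -> Free (m (val i))})) :
    dirprod (fun a : factor => Free (m (factor_rank a))) :=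
  fun a => g (tag a) (tagged a).
exists h => [x|g].
  by apply: dirprodP => -[i j]; rewrite /h /k /= ffunE.
by apply: dirprodP => i; apply/ffunP => j; rewrite /k ffunE.
Qed.

End ProdFree.

(** Otherwise infinitely many nonzero terms would make the partial sums
    unbounded. *)
Lemma summable_support (e : nat -> nat) N :
    (forall n, \sum_(2 <= i < n) e i <= N) ->
  exists M, forall i, M <= i -> e i = 0.
Proof.
move=> eN; apply: contrapT => noM.
have large k : exists n, k <= \sum_(2 <= i < n) e i.
  elim: k => [|k [n kn]]; first by exists 0.
  have [i [ni ei]] : exists i, maxn n 2 <= i /\ e i <> 0.
    apply: contrapT => noi; apply: noM; exists (maxn n 2) => i ni.
    by apply: contrapT => ei; apply: noi; exists i.
  exists i.+1; rewrite big_nat_recr /=; last by lia.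
  have : \sum_(2 <= j < n) e j <= \sum_(2 <= j < i) e j.
    have [n2|n2] := leqP n 2; first by rewrite big_geq.
    by rewrite [leqRHS](@big_cat_nat _ _ _ n) /=; lia.
  by lia.
by have [n] := large N.+1; rewrite ltnNge eN.
Qed.

Lemma factor_finite (e : nat -> nat) M : (forall i, M <= i -> e i = 0) ->
  exists s : seq (factor e), forall a, a \in s.
Proof.
move=> eM.
exists [seq (Tagged (fun i : {i : nat | 2 <= i} => 'I_(e (val i))) j : factor e)
  | i <- pmap insub (iota 0 M), j <- enum 'I_(e (val i))].
case=> i j; apply/allpairsPdep; exists i, j; split=> //; last exact: mem_enum.
rewrite mem_pmap_sub mem_iota /= add0n ltnNge; apply/negP => /eM ei.
by case: j => k; rewrite ei.
Qed.

Theorem corollary4p7 (r e : nat -> nat)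
    (r_gt0 : forall i, 2 <= i -> 0 < r i)
    (e_summable : exists N, forall n, \sum_(2 <= i < n) e i <= N)
    (r_coprime : forall i, 2 <= i -> 0 < e i -> gcdn (i - 1) (r i) = 1) :
  exists phi : Multiplicative.type
      (Out (prodFree (fun i => i) e))
      (Out (prodFree (fun i => r i ^ i * (i - 1) + 1) e)),
    injective phi.
Proof.
have [N /summable_support[M /factor_finite[s s_all]]] := e_summable.
have rank_ge2 (a : factor e) : 2 <= factor_rank a := valP (tag a).
have [k1 [k1M k1_bij]] := prodFree_dirprod id e.
have [k2 [k2M [k2' k2K k2'K]]] := prodFree_dirprod (fun i => r i ^ i * (i - 1) + 1) e.
apply: out_comp (out_iso k1M k1_bij) _.
have k2'M : {morph k2' : x y / (x * y)%g}.
  by move=> x y; apply: (can_inj k2K); rewrite k2M !k2'K.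
have k2'_bij : bijective k2' by exists k2.
apply: out_comp (out_iso k2'M k2'_bij).
apply: (@out_free_product _ s (@factor_rank e) r) => // a; first exact: r_gt0.
apply/eqP/r_coprime => //; exact: leq_ltn_trans (leq0n _) (ltn_ord (tagged a)).
Qed.
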